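(* Let $E$ be a finite set, let $\mathscr{L}_E$ be the set of Lagrangian subspaces of the symplectic space $V_E$ over $\mathbb{F}_2$, and let $\mathscr{B}_E$ be the set of binary delta-matroids with ground set $E$. Then the mapping $\nu_E$, which sends $L\in\mathscr{L}_E$ to the set system $(E;\Psi_L)$ with $\Psi_L=\{Y\subset E : L\cap\langle Y^\vee\sqcup(E\setminus Y)\rangle=0\}$, is a bijection from $\mathscr{L}_E$ onto $\mathscr{B}_E$.
   Context: Let $E^\vee$ be a disjoint copy of $E$, with $e^\vee\in E^\vee$ the copy of $e\in E$; for $Y\subset E$ write $Y^\vee=\{e^\vee:e\in Y\}$. $V_E$ is the $2|E|$-dimensional $\mathbb{F}_2$-vector space with basis $E\sqcup E^\vee$, with the symplectic (nondegenerate skew-symmetric) form defined on basis vectors by $(e,e^\vee)=(e^\vee,e)=1$ for $e\in E$ and $(u,v)=0$ for all other pairs of basis vectors. A subspace $L$ is Lagrangian if $(u,v)=0$ for all $u,v\in L$ and $\dim L=|E|$. Angle brackets denote the linear span in $V_E$, and $0$ is the zero subspace. A set system $(E;\Phi)$ is a finite set $E$ with a nonempty family $\Phi\subset 2^E$ of ''feasible'' subsets. A framed graph is a simple graph each of whose vertices carries a frame in $\mathbb{F}_2$; its adjacency matrix $A(G)$ over $\mathbb{F}_2$ has entry $1$ in position $(v,v')$, $v\ne v'$, iff $v,v'$ are adjacent, $0$ otherwise, and diagonal entries equal to the frames. $G$ is non-degenerate if $\det A(G)=1$ in $\mathbb{F}_2$ (the empty graph counts as non-degenerate). The non-degeneracy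 delta-matroid of $G$ is $(V(G);\Phi(G))$ with $\Phi(G)=\{U\subset V(G): \text{the induced subgraph } G_U \text{ is non-degenerate}\}$. For a set system $D=(E;\Phi)$ and $E'\subset E$, the twist is $D*E'=(E;\{\phi\,\Delta\, E':\phi\in\Phi\})$, where $\Delta$ is symmetric difference. A binary delta-matroid on $E$ is a set system of the form $(E;\Phi(G))*E'$ for some framed graph $G$ with vertex set $E$ and some (possibly empty) $E'\subset E$. *)

(* Defs.v *)
From HB Require Import structures.
From mathcomp Require Import all_boot all_order all_algebra.

Set Implicit Arguments.
Unset Strict Implicit.
Unset Printing Implicit Defensive.

Import GRing.Theory.
Local Open Scope ring_scope.

(* V_E is the space of coordinate functions on the disjoint union of E and    *)
(* its copy: inl e stands for e, and inr e for e^vee.                         *)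
Notation symp_space E := {ffun (E + E)%type -> ('F_2)^o}.

Section SymplecticSpace.

Variable E : finType.

Definition basis_vec (x : E + E) : symp_space E := [ffun y => (y == x)%:R].

Definition basis_form (x y : E + E) : 'F_2 :=
  match x, y with
  | inl e, inr f | inr e, inl f => (e == f)%:R
  | _, _ => 0
  end.

Definition symp_form (u v : symp_space E) : 'F_2 :=
  \sum_(x : E + E) \sum_(y : E + E) u x * v y * basis_form x y.

Definition lagrangian (L : {vspace symp_space E}) : Prop :=
  (forall u v, u \in L -> v \in L -> symp_form u v = 0) /\ \dim L = #|E|.

Definition coord_space (A : {set E + E}) : {vspace symp_space E} :=
  <<[seq basis_vec x | x in A]>>%VS.

(* nu_E, with values in arbitrary families of subsets of E: that the family   *)
(* is nonempty when L is Lagrangian is left to be proved.                     *)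
Definition nu (L : {vspace symp_space E}) : {set {set E}} :=
  [set Y : {set E} |
    (L :&: coord_space ((inr @: Y) :|: (inl @: (~: Y))) == 0)%VS].

End SymplecticSpace.

Record framed_graph (V : finType) := FramedGraph {
  adj : rel V;
  adj_sym : symmetric adj;
  adj_irr : irreflexive adj;
  frame : V -> 'F_2
}.

Section FramedGraph.

Variables (V : finType) (G : framed_graph V).

Definition adjacency_mx : 'M['F_2]_#|V| :=
  \matrix_(i, j) (if i == j then frame G (enum_val i)
                  else (adj G (enum_val i) (enum_val j))%:R).

(* \det of the 0 x 0 matrix is 1, so the empty graph is non-degenerate. *)
Definition nondegenerate : bool := \det adjacency_mx == 1.

Variable U : {set V}.

Definition induced_adj : rel {x : V | x \in U} :=
  fun x y => adj G (val x) (val y).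

Lemma induced_adj_sym : symmetric induced_adj.
Proof. by move=> x y; apply: adj_sym. Qed.

Lemma induced_adj_irr : irreflexive induced_adj.
Proof. by move=> x; apply: adj_irr. Qed.

Definition induced_subgraph : framed_graph {x : V | x \in U} :=
  FramedGraph induced_adj_sym induced_adj_irr (fun x => frame G (val x)).

End FramedGraph.

Section SetSystems.

Variable E : finType.

Definition set_system (Phi : {set {set E}}) : Prop := Phi != set0.

Definition nondegeneracy_dm (G : framed_graph E) : {set {set E}} :=
  [set U : {set E} | nondegenerate (induced_subgraph G U)].

Definition symdiff (A B : {set E}) : {set E} := (A :\: B) :|: (B :\: A).

Definition twist (Phi : {set {set E}}) (E' : {set E}) : {set {set E}} :=
  [set symdiff phi E' | phi in Phi].

Definition binary_delta_matroid (Phi : {set {set E}}) : Prop :=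
  set_system Phi /\
  exists (G : framed_graph E) (E' : {set E}),
    Phi = twist (nondegeneracy_dm G) E'.

End SetSystems.

(* Main.v *)
(* Choose [T] in [nu L]. Then [L] is the graph of a linear map from the
   coordinates complementary to [T^vee + (E - T)] to those along it, and [L] is
   isotropic iff the matrix [A] of this map is symmetric, i.e. iff it is the
   adjacency matrix of a framed graph. A vector of [L] lying in
   [<Y^vee + (E - Y)>] is a kernel vector of the principal submatrix of [A] on
   the symmetric difference of [Y] and [T], whence [nu L] is a twist of the
   non-degeneracy delta-matroid. Finally the principal minors of size 1 and 2
   determine a symmetric matrix over F_2. *)
Require Import Defs.
From HB Require Import structures.
From mathcomp Require Import all_boot all_order all_algebra.

Set Implicit Arguments.
Unset Strict Implicit.
Unset Printing Implicit Defensive.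

Import GRing.Theory.
Local Open Scope ring_scope.

(** * Arithmetic in F_2 *)

Lemma F2_cases (x : 'F_2) : x = 0 \/ x = 1.
Proof. by case: x => [[|[|m]] ltm] //; [left | right]; apply/val_inj. Qed.

Lemma F2_addxx (x : 'F_2) : x + x = 0.
Proof. by case: (F2_cases x) => ->; apply/val_inj. Qed.

Lemma F2_add_eq0 (x y : 'F_2) : x + y = 0 -> x = y.
Proof. by move=> xy0; rewrite -[RHS]add0r -xy0 -addrA F2_addxx addr0. Qed.

Lemma F2_natr_neq0 (x : 'F_2) : (x != 0)%:R = x.
Proof. by case: (F2_cases x) => ->; rewrite ?eqxx ?oner_eq0. Qed.

Lemma F2_eq1 (x : 'F_2) : (x == 1) = (x != 0).
Proof. by case: (F2_cases x) => ->. Qed.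

(** * The adjacency matrix of a framed graph and its kernel *)

Section Gram.

Variable V : finType.
Implicit Type G : framed_graph V.

(** The adjacency matrix indexed by vertices instead of ordinals, so that passing to an induced
    subgraph needs no renumbering. *)
Definition gram G (e f : V) : 'F_2 :=
  if e == f then frame G e else (adj G e f)%:R.

Lemma gram_sym G e f : gram G e f = gram G f e.
Proof. by rewrite /gram eq_sym; case: eqP => [->|_] //; rewrite adj_sym. Qed.

(** Over F_2, determinant 1 means nonzero determinant, hence trivial kernel. [det0P] yields left
    kernel vectors; symmetry makes them right ones. *)
Lemma nondegenerateP G :
  reflect (forall x : V -> 'F_2,
             (forall e, \sum_f gram G e f * x f = 0) -> forall e, x e = 0)
          (Defs.nondegenerate G).
Proof.
have adjE i j : adjacency_mx G i j = gram G (enum_val i) (enum_val j).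
  by rewrite mxE /gram (inj_eq enum_val_inj).
rewrite /Defs.nondegenerate F2_eq1; apply: (iffP idP) => [/det0P ndG x kx | ndG].
  suff /rowP x0 : \row_i x (enum_val i) = 0 :> 'rV_#|V|.
    by move=> e; have := x0 (enum_rank e); rewrite !mxE enum_rankK.
  apply/eqP; case: eqP => // /eqP nz; case: ndG; exists (\row_i x (enum_val i)) => //.
  apply/rowP => j; rewrite !mxE -[RHS](kx (enum_val j)).
  rewrite [RHS](reindex (enum_val : 'I_#|V| -> V)) /=; last first.
    exact/onW_bij/enum_val_bij.
  by apply: eq_bigr => i _; rewrite [in LHS]mxE adjE gram_sym mulrC.
apply/det0P => -[v nzv kv]; case/eqP: nzv; apply/rowP => i.
rewrite mxE -[i]enum_valK; apply: (ndG (fun e => v 0 (enum_rank e))) => e.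
have /rowP/(_ (enum_rank e)) := kv; rewrite !mxE => {2}<-.
rewrite (reindex (enum_val : 'I_#|V| -> V)) /=; last first.
  exact/onW_bij/enum_val_bij.
by apply: eq_bigr => k _; rewrite adjE enum_valK enum_rankK gram_sym mulrC.
Qed.

End Gram.

(** * Feasible sets as principal minors, and recovery of the matrix from them *)

Section NondegeneracyDeltaMatroid.

Variable V : finType.
Implicit Types (G H : framed_graph V) (U : {set V}).

(** Extension by zero turns kernel vectors of the submatrix on [U] into functions on all of [V], so
    different [U] can be compared on one type. *)
Lemma mem_nondegeneracy_dm G U :
  reflect (forall x : V -> 'F_2,
             (forall e, e \notin U -> x e = 0) ->
             (forall e, e \in U -> \sum_f gram G e f * x f = 0) ->
             forall e, x e = 0)
          (U \in nondegeneracy_dm G).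
Proof.
have sumU (x : V -> 'F_2) : (forall e, e \notin U -> x e = 0) ->
  forall e : {e | e \in U}, \sum_f gram G (val e) f * x f =
    \sum_f gram (induced_subgraph G U) e f * x (val f).
  move=> x0 e; rewrite (bigID (mem U)) /= [X in _ + X]big1 => [|f /x0->]; last first.
    by rewrite mulr0.
  by rewrite addr0 big_sub.
rewrite inE; apply: (iffP (nondegenerateP _)) => ndU x.
  move=> x0 kx e; have [eU|/x0//] := boolP (e \in U).
  by apply: (ndU (x \o val) _ (Sub e eU)) => f; rewrite -sumU //; apply/kx/valP.
move=> kx e.
pose y f := if insub f is Some g then x g else 0.
have yE f : y (val f) = x f by rewrite /y valK.
have y0 f : f \notin U -> y f = 0 by move=> fU; rewrite /y insubN.
rewrite -yE; apply: ndU => // f fU.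
rewrite (sumU _ y0 (Sub f fU)) -[RHS](kx (Sub f fU)).
by apply: eq_bigr => g _; rewrite yE.
Qed.


Lemma set1_nondegeneracy_dm G e :
  ([set e] \in nondegeneracy_dm G) = (gram G e e != 0).
Proof.
have sum1 (x : V -> 'F_2) g : (forall f, f \notin [set e] -> x f = 0) ->
    \sum_f gram G g f * x f = gram G g e * x e.
  move=> x0; rewrite (bigD1 e) //= big1 ?addr0 // => f fe.
  by rewrite x0 ?mulr0 // inE.
apply/mem_nondegeneracy_dm/idP => [nd | nz x x0 kx f].
  apply/eqP => gee; pose x f : 'F_2 := (f == e)%:R.
  have x0 f : f \notin [set e] -> x f = 0 by rewrite inE /x => /negPf->.
  suff /eqP : x e = 0 by rewrite /x eqxx oner_eq0.
  by apply: (nd _ x0) => f /set1P->; rewrite sum1 // gee mul0r.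
have [/set1P->|/x0//] := boolP (f \in [set e]).
have /eqP := kx e (set11 e).
by rewrite sum1 // mulf_eq0 (negPf nz) => /eqP.
Qed.

(** The off-diagonal entry enters the 2 x 2 determinant squared, and squaring is the identity on
    F_2. *)
Lemma set2_nondegeneracy_dm G e f : e != f ->
  ([set e; f] \in nondegeneracy_dm G) = (gram G e e * gram G f f != gram G e f).
Proof.
move=> nef.
have sum2 (x : V -> 'F_2) g : (forall h, h \notin [set e; f] -> x h = 0) ->
    \sum_h gram G g h * x h = gram G g e * x e + gram G g f * x f.
  move=> x0; rewrite (bigD1 e) //= (bigD1 f) 1?eq_sym //= big1 ?addr0 // => h /andP[he hf].
  by rewrite x0 ?mulr0 // !inE negb_or he.
apply/mem_nondegeneracy_dm/idP => [nd | nz x x0 kx g].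
  apply/eqP => det0.
  have ker (s t : 'F_2) : gram G e e * s + gram G e f * t = 0 ->
      gram G e f * s + gram G f f * t = 0 -> s = 0 /\ t = 0.
    move=> k1 k2; pose x h := if h == e then s else if h == f then t else 0.
    have xe : x e = s by rewrite /x eqxx.
    have xf : x f = t by rewrite /x eq_sym (negPf nef) eqxx.
    have x0 h : h \notin [set e; f] -> x h = 0.
      by rewrite !inE negb_or /x => /andP[/negPf-> /negPf->].
    rewrite -xe -xf; suff z : forall h, x h = 0 by [].
    apply: (nd _ x0) => h /set2P[]->; rewrite sum2 // xe xf //.
    by rewrite (gram_sym G f e).
  (* The off-diagonal entry is now the product of the diagonal ones, so the diagonal fixes the
     matrix; each of the four cases has an explicit nonzero kernel vector. *)
  move: ker; rewrite -det0.
  case: (F2_cases (gram G e e)) => ->; case: (F2_cases (gram G f f)) => -> ker.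
  - by have [|| /eqP] := ker 1 0; rewrite ?oner_eq0 // ?mul0r ?mul1r ?mulr0 ?mulr1 ?add0r ?addr0 ?F2_addxx.
  - by have [|| /eqP] := ker 1 0; rewrite ?oner_eq0 // ?mul0r ?mul1r ?mulr0 ?mulr1 ?add0r ?addr0 ?F2_addxx.
  - by have [|| /eqP] := ker 0 1; rewrite ?oner_eq0 // ?mul0r ?mul1r ?mulr0 ?mulr1 ?add0r ?addr0 ?F2_addxx.
  - by have [|| /eqP] := ker 1 1; rewrite ?oner_eq0 // ?mul0r ?mul1r ?mulr0 ?mulr1 ?add0r ?addr0 ?F2_addxx.
have := kx e (set21 e f); have := kx f (set22 e f); rewrite !sum2 //.
rewrite (gram_sym G f e) => k2 k1.
suff [xe xf] : x e = 0 /\ x f = 0.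
  by have [/set2P[]->|/x0//] := boolP (g \in [set e; f]).
move: nz k1 k2.
case: (F2_cases (gram G e e)) => ->; case: (F2_cases (gram G f f)) => ->;
  case: (F2_cases (gram G e f)) => ->; rewrite !(mul0r, mul1r, add0r, addr0, eqxx) //.
  by move=> _ -> /eqP; rewrite addr0 => /eqP.
by move=> _ /[swap] -> /eqP; rewrite add0r => /eqP.
Qed.

(** Singletons give the diagonal, then pairs the remaining entries. Entries are compared rather than
    records, whose fields include functions and proofs. *)
Lemma nondegeneracy_dm_inj G H :
  nondegeneracy_dm G = nondegeneracy_dm H -> gram G =2 gram H.
Proof.
move=> eqGH.
have diag e : gram G e e = gram H e e.
  have := set1_nondegeneracy_dm G e; rewrite eqGH set1_nondegeneracy_dm.
  by case: (F2_cases (gram G e e)) => ->; case: (F2_cases (gram H e e)) => ->.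
move=> e f; have [<-|nef] := eqVneq e f; first exact: diag.
have := set2_nondegeneracy_dm G nef; rewrite eqGH set2_nondegeneracy_dm // !diag.
case: (F2_cases (gram G e f)) => ->; case: (F2_cases (gram H e f)) => -> //;
  by case: (F2_cases (gram H e e * gram H f f)) => ->.
Qed.

Lemma gram_surj (A : V -> V -> 'F_2) :
  (forall e f, A e f = A f e) -> exists G, gram G =2 A.
Proof.
move=> symA; pose r : rel V := fun e f => (e != f) && (A e f != 0).
have rsym : symmetric r by move=> e f; rewrite /r eq_sym symA.
have rirr : irreflexive r by move=> e; rewrite /r eqxx.
exists (FramedGraph rsym rirr (fun e => A e e)) => e f; rewrite /gram /= /r.
by case: eqP => [->|_] //; rewrite F2_natr_neq0.
Qed.

End NondegeneracyDeltaMatroid.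

Lemma symdiffK (V : finType) (A B : {set V}) : symdiff (symdiff A B) B = A.
Proof. by apply/setP => x; rewrite !inE; case: (x \in A); case: (x \in B). Qed.

Lemma mem_twist (V : finType) (Phi : {set {set V}}) (A B : {set V}) :
  (B \in twist Phi A) = (symdiff B A \in Phi).
Proof.
apply/imsetP/idP => [[C CPhi ->]|]; first by rewrite symdiffK.
by exists (symdiff B A); rewrite ?symdiffK.
Qed.

(** * Lagrangian subspaces as graphs of symmetric matrices *)

Section Lagrangians.

Variable E : finType.
Implicit Types (T Y : {set E}) (G : framed_graph E).
Implicit Types (u v : symp_space E) (L M : {vspace symp_space E}).

Lemma mem_coord_space (A : {set E + E}) u :
  reflect (forall x, x \notin A -> u x = 0) (u \in coord_space A).
Proof.
apply: (iffP idP) => [uA x xA | u0].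
  rewrite (coord_span (X := in_tuple _) uA) sum_ffunE big1 // => i _.
  rewrite ffunE (_ : _ x = 0) ?scaler0 //.
  have /mapP[y] : (in_tuple [seq basis_vec x | x in A])`_i \in
      [seq basis_vec x | x in A] by rewrite mem_nth.
  rewrite mem_enum => yA ->; rewrite ffunE; case: eqP => // xy.
  by rewrite xy yA in xA.
suff -> : u = \sum_(x in A) u x *: basis_vec x.
  by apply: memv_suml => x xA; apply/memvZ/memv_span/image_f.
apply/ffunP => y; rewrite sum_ffunE; have [yA|/[dup] yA /u0->] := boolP (y \in A).
  rewrite (bigD1 y) //= big1 ?addr0 => [|x /andP[_ xy]]; rewrite !ffunE.
    by rewrite eqxx /GRing.scale /= mulr1.
  by rewrite eq_sym (negPf xy) scaler0.
rewrite big1 // => x xA; rewrite !ffunE; case: eqP => [yx|]; last by rewrite scaler0.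
by rewrite yx xA in yA.
Qed.

(** The coordinates of [u] on the transversal [T^vee + (E - T)]; [across] takes those on the
    complementary transversal. Both are indexed by [E], so a matrix over [E] can map one to the
    other. *)
Definition along T u : {ffun E -> ('F_2)^o} :=
  [ffun e => u (if e \in T then inr e else inl e)].

Definition across T u : {ffun E -> ('F_2)^o} :=
  [ffun e => u (if e \in T then inl e else inr e)].

Fact across_is_linear T : linear (across T).
Proof. by move=> a u v; apply/ffunP => e; rewrite !ffunE. Qed.

HB.instance Definition _ T :=
  GRing.isLinear.Build _ _ _ _ (across T) (across_is_linear T).

Fact along_is_linear T : linear (along T).
Proof. by move=> a u v; apply/ffunP => e; rewrite !ffunE. Qed.

HB.instance Definition _ T :=
  GRing.isLinear.Build _ _ _ _ (along T) (along_is_linear T).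

Lemma along_across_inj T u v :
  along T u = along T v -> across T u = across T v -> u = v.
Proof.
move=> /ffunP al /ffunP ac; apply/ffunP => -[] e; have := al e; have := ac e;
by rewrite !ffunE; case: ifP.
Qed.

(** The coordinate space attached to [Y] is the kernel of [across Y], so membership in [nu L] is
    injectivity of [across Y] on [L]. *)
Lemma nuP L Y :
  reflect (forall u, u \in L -> across Y u = 0 -> u = 0) (Y \in nu L).
Proof.
have mem u : (u \in coord_space ((inr @: Y) :|: (inl @: (~: Y)))) =
    (across Y u == 0).
  apply/mem_coord_space/eqP => [u0 | /ffunP ac [] e].
  - apply/ffunP => e; rewrite !ffunE; apply: u0; rewrite inE.
    by case: ifP => eY; apply/norP; split; apply/imsetP => -[f] //;
      rewrite ?inE => fY [ef]; move: eY fY; rewrite ef => ->.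
  - rewrite inE => /norP[_]; rewrite mem_imset ?inE => [|? ? []//]; rewrite negbK => eY.
    by have := ac e; rewrite !ffunE eY.
  - rewrite inE => /norP[]; rewrite mem_imset => [/negPf eY _|? ? []//].
    by have := ac e; rewrite !ffunE eY.
rewrite inE -subv0; apply: (iffP subvP) => [LY u uL uY | LY u].
  by apply/eqP; rewrite -memv0; apply: LY; rewrite memv_cap uL mem uY eqxx.
by rewrite memv_cap mem memv0 => /andP[uL /eqP uY]; apply/eqP/LY.
Qed.

Lemma symp_formE u v :
  symp_form u v = \sum_e (u (inl e) * v (inr e) + u (inr e) * v (inl e)).
Proof.
have sum1 (F : E -> 'F_2) e : \sum_f F f * (e == f)%:R = F e.
  rewrite (bigD1 e) //= big1 => [|f fe]; first by rewrite eqxx mulr1 addr0.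
  by rewrite eq_sym (negPf fe) mulr0.
have sum0 (F : E -> 'F_2) : \sum_f F f * 0 = 0.
  by rewrite big1 // => f _; rewrite mulr0.
rewrite /symp_form big_sumType /= -big_split /=; apply: eq_bigr => e _.
by rewrite !big_sumType /= !sum1 !sum0 add0r addr0.
Qed.

(** Exchanging [e] with its copy preserves the form, there being no signs over F_2. *)
Lemma symp_form_along T u v :
  symp_form u v =
    \sum_e (along T u e * across T v e + across T u e * along T v e).
Proof.
rewrite symp_formE; apply: eq_bigr => e _; rewrite !ffunE.
by case: ifP => // _; rewrite addrC.
Qed.

Definition gram_app G (x : {ffun E -> ('F_2)^o}) : {ffun E -> ('F_2)^o} :=
  [ffun e => \sum_f gram G e f * x f].

Lemma gram_app_sym G (x y : {ffun E -> ('F_2)^o}) :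
  \sum_e gram_app G x e * y e = \sum_e x e * gram_app G y e.
Proof.
under eq_bigr do rewrite ffunE mulr_suml.
rewrite exchange_big; apply: eq_bigr => e _; rewrite ffunE mulr_sumr.
by apply: eq_bigr => f _; rewrite gram_sym mulrA; congr (_ * _); rewrite mulrC.
Qed.

Definition graph_vec G T (x : {ffun E -> ('F_2)^o}) : symp_space E :=
  [ffun z => match z with
             | inl e => if e \in T then x e else gram_app G x e
             | inr e => if e \in T then gram_app G x e else x e
             end].

Fact graph_vec_is_linear G T : linear (graph_vec G T).
Proof.
move=> a x y.
have appE e : \sum_f gram G e f * (a *: x + y) f =
    a * (\sum_f gram G e f * x f) + \sum_f gram G e f * y f.
  rewrite mulr_sumr -big_split /=; apply: eq_bigr => f _.
  by rewrite !ffunE mulrDr; congr (_ + _); apply: mulrCA.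
by apply/ffunP => -[] e; rewrite !ffunE; case: ifP => _; rewrite ?appE // !ffunE.
Qed.

HB.instance Definition _ G T :=
  GRing.isLinear.Build _ _ _ _ (graph_vec G T) (graph_vec_is_linear G T).

Lemma along_graph_vec G T x : along T (graph_vec G T x) = gram_app G x.
Proof. by apply/ffunP => e; rewrite ffunE; case: ifP => eT; rewrite ffunE eT. Qed.

Lemma across_graph_vec G T x : across T (graph_vec G T x) = x.
Proof. by apply/ffunP => e; rewrite ffunE; case: ifP => eT; rewrite ffunE eT. Qed.

Definition graph_space G T : {vspace symp_space E} :=
  limg (linfun (graph_vec G T)).

Lemma mem_graph_space G T u :
  (u \in graph_space G T) = (along T u == gram_app G (across T u)).
Proof.
apply/memv_imgP/eqP => [[x _ ->]|uG].
  by rewrite lfunE along_graph_vec across_graph_vec.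
exists (across T u); rewrite ?memvf // lfunE.
by apply: (@along_across_inj T); rewrite ?along_graph_vec ?across_graph_vec.
Qed.

Lemma dim_ffun : \dim {:{ffun E -> ('F_2)^o}} = #|E|.
Proof. by rewrite dimvf /dim /= muln1. Qed.

(** By symmetry of the matrix the two halves of the form agree and cancel in characteristic 2; the
    dimension is right because [across T] inverts [graph_vec G T]. *)
Lemma lagrangian_graph_space G T : lagrangian (graph_space G T).
Proof.
split=> [u v|].
  rewrite !mem_graph_space (symp_form_along T) => /eqP-> /eqP->.
  by rewrite big_split /= gram_app_sym F2_addxx.
rewrite -dim_ffun limg_dim_eq //; apply/eqP; rewrite -subv0.
apply/subvP => x; rewrite memv_cap memvf /= memv_ker lfunE memv0 /=.
by move=> /eqP x0; rewrite -(across_graph_vec G T x) x0 linear0.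
Qed.

(** The source of the twist: on the graph of [A], [across Y u = 0] says that [x = across T u]
    vanishes off the symmetric difference and [A x] vanishes on it. *)
Lemma across_symdiff T Y u e :
  across Y u e = if e \in symdiff Y T then along T u e else across T u e.
Proof. by rewrite !ffunE !inE; case: (e \in T); case: (e \in Y). Qed.

Lemma nu_graph_space G T : nu (graph_space G T) = twist (nondegeneracy_dm G) T.
Proof.
apply/setP => Y; rewrite mem_twist.
apply/nuP/mem_nondegeneracy_dm => [LY x x0 kx e | ndY u].
  pose y : {ffun E -> ('F_2)^o} := finfun x.
  have yE f : y f = x f by rewrite ffunE.
  rewrite -(yE e) -[y](across_graph_vec G T) (LY (graph_vec G T y)).
  - by rewrite linear0 ffunE.
  - by rewrite mem_graph_space along_graph_vec across_graph_vec.
  apply/ffunP => f; rewrite (across_symdiff T) along_graph_vec across_graph_vec !ffunE.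
  case: ifP => [fY|/negbT/x0->//]; rewrite -[RHS](kx f fY).
  by apply: eq_bigr => g _; rewrite ffunE.
rewrite mem_graph_space => /eqP uG /ffunP u0.
have acu : across T u = 0.
  apply/ffunP => e; rewrite [RHS]ffunE; apply: ndY => {}e eY.
    by have := u0 e; rewrite (across_symdiff T) (negPf eY) [RHS]ffunE.
  by have := u0 e; rewrite (across_symdiff T) eY uG !ffunE.
apply: (@along_across_inj T); rewrite ?linear0 // uG acu.
by apply/ffunP => e; rewrite !ffunE big1 // => f _; rewrite ffunE mulr0.
Qed.

Lemma lagrangian_is_graph L T :
  lagrangian L -> T \in nu L -> exists G, L = graph_space G T.
Proof.
move=> [isoL dimL] /nuP LT.
(* [across T] is injective on [L], whose dimension is [#|E|], hence it is onto. *)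
have acL : (linfun (across T) @: L = fullv)%VS.
  apply/eqP; rewrite eqEdim subvf dim_ffun -dimL limg_dim_eq //=.
  apply/eqP; rewrite -subv0; apply/subvP => u.
  rewrite memv_cap memv_ker lfunE memv0 => /andP[uL /eqP u0].
  by apply/eqP/LT.
have liftP e : exists u, (u \in L) && (across T u == [ffun f => (f == e)%:R]).
  have : [ffun f => (f == e)%:R] \in (linfun (across T) @: L)%VS by rewrite acL memvf.
  by case/memv_imgP => u uL ->; exists u; rewrite uL lfunE /=.
(* The vectors [w e] of [L] lift the standard basis; their [along T] parts will be the columns of
   the matrix. *)
pose w e := xchoose (liftP e).
have wL e : w e \in L by case/andP: (xchooseP (liftP e)).
have acw e : across T (w e) = [ffun f => (f == e)%:R].
  by case/andP: (xchooseP (liftP e)) => _ /eqP.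
have decomp u : u \in L -> u = \sum_e across T u e *: w e.
  move=> uL; apply/subr0_eq/LT; first by apply/memvB/memv_suml => // e _; apply/memvZ.
  apply/eqP; rewrite linearB linear_sum subr_eq0.
  apply/eqP/ffunP => e; rewrite sum_ffunE (bigD1 e) //=.
  rewrite big1 => [|f fe]; rewrite linearZ /= acw !ffunE.
    by rewrite eqxx addr0 /GRing.scale /= mulr1.
  by rewrite eq_sym (negPf fe) scaler0.
have [|G gramG] := @gram_surj E (fun e f => along T (w f) e).
  (* The form of [w e] and [w f] is the sum of the entries at [(e, f)] and [(f, e)], so isotropy
     gives symmetry. *)
  move=> e f; have := isoL _ _ (wL e) (wL f); rewrite (symp_form_along T).
  rewrite big_split /= (bigD1 f) //= [X in _ + X](bigD1 e) //=.
  rewrite !acw !big1 => [|g ge|g gf]; rewrite !ffunE ?eqxx ?mulr1 ?mul1r ?addr0.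
  - by move/F2_add_eq0->.
  - by rewrite (negPf ge) mul0r.
  by rewrite (negPf gf) mulr0.
exists G; apply/eqP; rewrite eqEdim (lagrangian_graph_space G T).2 dimL leqnn andbT.
apply/subvP => u uL; rewrite mem_graph_space; apply/eqP.
rewrite {1}(decomp u uL) linear_sum; apply/ffunP => e; rewrite sum_ffunE ffunE.
by apply: eq_bigr => f _; rewrite linearZ ffunE gramG mulrC.
Qed.

(** * Existence of a coordinate transversal meeting an isotropic subspace trivially *)

Lemma nu_neq0 L :
  (forall u v, u \in L -> v \in L -> symp_form u v = 0) -> nu L != set0.
Proof.
(* A transversal whose span meets [L] trivially is built one element [e] at a
   time: if adding [e] and adding its copy both failed, [L] would contain a
   vector with [e]-coordinate 1 and one with [e^vee]-coordinate 1, all other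
   coordinates lying on a common isotropic transversal, so their form is 1. *)
move=> isoL.
(* A partial transversal over [S]: it takes the copy of [e] when [e] is in [T], and [e] itself
   otherwise. The induction is on the size of [S]. *)
pose C (S T : {set E}) : {set E + E} :=
  [set z | match z with
           | inl e => (e \in S) && (e \notin T)
           | inr e => (e \in S) && (e \in T)
           end].
suff [T LT] : exists T, (L :&: coord_space (C setT T) == 0)%VS.
  apply/set0Pn; exists T; rewrite inE.
  suff <- : C setT T = (inr @: T) :|: (inl @: ~: T) by [].
  apply/setP => -[] e; rewrite !inE.
    rewrite [X in _ || X]mem_imset ?inE => [|? ? []//].
    by case: imsetP => // -[].
  rewrite mem_imset => [|? ? []//]; rewrite [X in _ || X](_ : _ = false) ?orbF //.
  by apply/imsetP => -[].
move cardS: #|[set: E]| => n; elim: n [set: E] cardS => [|n IHn] S.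
  move=> /eqP; rewrite cards_eq0 => /eqP->; exists set0.
  rewrite -subv0; apply/subvP => u; rewrite memv_cap => /andP[_ /mem_coord_space u0].
  by rewrite memv0; apply/eqP/ffunP => z; rewrite u0 ?ffunE // inE; case: z => e; rewrite inE.
move=> cardS; have /card_gt0P[e eS] : (0 < #|S|)%N by rewrite cardS.
have [|T LT] := IHn (S :\ e); first by move: cardS; rewrite (cardsD1 e) eS => -[].
have [|nz1] := eqVneq (L :&: coord_space (C S (T :\ e)))%VS 0%VS.
  by exists (T :\ e); apply/eqP.
have [|nz2] := eqVneq (L :&: coord_space (C S (e |: T)))%VS 0%VS.
  by exists (e |: T); apply/eqP.
have := memv_pick (L :&: coord_space (C S (T :\ e))).
have := memv_pick (L :&: coord_space (C S (e |: T))).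
move: nz1 nz2; rewrite -!vpick0; move: (vpick _) (vpick _) => v u nzu nzv.
rewrite !memv_cap => /andP[vL /mem_coord_space v0] /andP[uL /mem_coord_space u0].
(* Away from [e] both vectors live on the same transversal, so only [u (inl e) * v (inr e)] survives
   in the form. *)
have := isoL u v uL vL; rewrite symp_formE (bigD1 e) //= big1 => [|g ge]; last first.
  have [gST|gST] := boolP ((g \in S) && (g \notin T)).
    rewrite (u0 (inr g)) ?(v0 (inr g)) ?mulr0 ?mul0r ?addr0 // !inE.
      by case/andP: gST => _ /negPf->; rewrite (negPf ge) andbF.
    by case/andP: gST => _ /negPf->; rewrite !andbF.
  rewrite (u0 (inl g)) ?(v0 (inl g)) ?mulr0 ?mul0r ?addr0 // !inE (negPf ge) //=.
rewrite (u0 (inr e)) ?inE ?eqxx ?andbF // mul0r !addr0 => /eqP.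
rewrite mulf_eq0 => /orP[] /eqP ze.
(* The vector whose coordinate vanishes lies over [S :\ e], where [LT] forces it to be zero. *)
- case/eqP: nzu; apply/eqP; rewrite -memv0 -(eqP LT) memv_cap uL.
  apply/mem_coord_space => -[] g; have [->|ge] := eqVneq g e; rewrite ?ze //;
    rewrite inE => zT; apply: u0; move: zT;
    by rewrite !inE ?eqxx ?ge ?andbF.
case/eqP: nzv; apply/eqP; rewrite -memv0 -(eqP LT) memv_cap vL.
apply/mem_coord_space => -[] g; have [->|ge] := eqVneq g e; rewrite ?ze //;
  rewrite inE => zT; apply: v0; move: zT;
  by rewrite !inE ?eqxx ?ge ?(negPf ge) ?andbF ?orTb.
Qed.

End Lagrangians.

(** * The bijection *)

Theorem theorem2p1 (E : finType) :
  [/\ (forall L : {vspace symp_space E},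
         lagrangian L -> binary_delta_matroid (nu L)),
      (forall L M : {vspace symp_space E},
         lagrangian L -> lagrangian M -> nu L = nu M -> L = M)
    & (forall Phi : {set {set E}}, binary_delta_matroid Phi ->
         exists2 L : {vspace symp_space E}, lagrangian L & nu L = Phi)].
Proof.
split=> [L lagL | L M lagL lagM eq_nu | Phi [_ [G [T ->]]]].
- have nz := nu_neq0 lagL.1; have /set0Pn[T LT] := nz.
  have [G defL] := lagrangian_is_graph lagL LT.
  by split=> //; exists G, T; rewrite defL nu_graph_space.
- have /set0Pn[T LT] := nu_neq0 lagL.1.
  have [G defL] := lagrangian_is_graph lagL LT.
  (* As [nu L = nu M], one [T] presents both subspaces as graphs, so only their matrices remain to
     be compared. *)
  have [|H defM] := @lagrangian_is_graph _ M T lagM; first by rewrite -eq_nu.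
  have /nondegeneracy_dm_inj eqGH : nondegeneracy_dm G = nondegeneracy_dm H.
    apply/setP => U; move: eq_nu; rewrite defL defM !nu_graph_space => /setP.
    by move=> /(_ (symdiff U T)); rewrite !mem_twist symdiffK.
  rewrite defL defM; apply/vspaceP => u; rewrite !mem_graph_space.
  congr (_ == _); apply/ffunP => e; rewrite !ffunE.
  by apply: eq_bigr => f _; rewrite eqGH.
exists (graph_space G T); first exact: lagrangian_graph_space.
exact: nu_graph_space.
Qed.
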